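(* Let $\mathcal C$ be a non-empty class of Banach lattices such that $\overline{\mathcal C}$ is closed under lattice quotients (quotients by closed ideals). Let $X_0,X_1,X_2\in\overline{\mathcal C}$ and let $T_i:X_0\to X_i$ ($i=1,2$) be bounded lattice homomorphisms. Then there exist $PO\in\overline{\mathcal C}$ and lattice homomorphisms $S_i:X_i\to PO$ ($i=1,2$) with $\max\{\|S_1\|,\|S_2\|\}\le1$ and $S_1T_1=S_2T_2$, such that for every $Z\in\overline{\mathcal C}$ and lattice homomorphisms $R_i:X_i\to Z$ with $R_1T_1=R_2T_2$ there is a unique lattice homomorphism $\gamma:PO\to Z$ with $\gamma S_i=R_i$ ($i=1,2$), and moreover $\|\gamma\|\le\max\{\|R_1\|,\|R_2\|\}$.
   Context: $\overline{\mathcal C}$ is the class of Banach lattices lattice isometric to a closed sublattice of some $(\bigoplus_{\gamma\in\Gamma}X_\gamma)_\infty$ with all $X_\gamma\in\mathcal C$ (repetitions allowed). *)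

(* Defs.v *)
From HB Require Import structures.
From mathcomp Require Import all_boot all_order all_algebra.
From mathcomp Require Import all_classical all_reals all_analysis.
Set Implicit Arguments. Unset Strict Implicit. Unset Printing Implicit Defensive.
Import Order.TTheory GRing.Theory Num.Theory.
Import numFieldNormedType.Exports.
Local Open Scope ring_scope.

Record BanachLattice (R : realType) := {
  BL_sort :> completeNormedModType R;
  BL_le : BL_sort -> BL_sort -> Prop;
  BL_join : BL_sort -> BL_sort -> BL_sort;
  BL_le_refl : forall x, BL_le x x;
  BL_le_anti : forall x y, BL_le x y -> BL_le y x -> x = y;
  BL_le_trans : forall x y z, BL_le x y -> BL_le y z -> BL_le x z;
  BL_le_add : forall x y z, BL_le x y -> BL_le (x + z) (y + z);
  BL_le_scale : forall (a : R) x y, 0 <= a -> BL_le x y -> BL_le (a *: x) (a *: y);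
  BL_join_ubl : forall x y, BL_le x (BL_join x y);
  BL_join_ubr : forall x y, BL_le y (BL_join x y);
  BL_join_least : forall x y z, BL_le x z -> BL_le y z -> BL_le (BL_join x y) z;
  BL_lattice_norm : forall x y,
    BL_le (BL_join x (- x)) (BL_join y (- y)) -> `|x| <= `|y|
}.

Definition is_linear (R : realType) (X Y : BanachLattice R) (f : X -> Y) :=
  forall (a : R) (x y : X), f (a *: x + y) = a *: f x + f y.

(* lattice homomorphisms: linear maps preserving finite suprema
   (hence also infima); they are automatically bounded *)
Definition lattice_hom (R : realType) (X Y : BanachLattice R) (f : X -> Y) :=
  is_linear f /\ forall x y : X, f (BL_join x y) = BL_join (f x) (f y).

Definition bounded_op (R : realType) (X Y : BanachLattice R) (f : X -> Y) :=
  exists C : R, forall x : X, `|f x| <= C * `|x|.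

Definition opnorm_le (R : realType) (X Y : BanachLattice R) (f : X -> Y) (c : R) :=
  forall x : X, `|f x| <= c * `|x|.

Definition BLclass (R : realType) := BanachLattice R -> Prop.

(* X is lattice isometric to a (necessarily closed) sublattice of the
   l_infty-sum (\bigoplus_{g in G} F g)_infty, all F g in C (repetitions allowed).
   J : X -> forall g, F g is linear, preserves joins (coordinatewise lattice
   operations of the l_infty-sum), takes values in bounded families, and
   ||x|| = sup_g ||J x g|| (the l_infty norm, 0 for empty G). *)
Definition closure_class (R : realType) (C : BLclass R) : BLclass R :=
  fun X => exists (G : Type) (F : G -> BanachLattice R)
                  (J : X -> forall g : G, F g),
    (forall g, C (F g)) /\
    (forall (a : R) (x y : X) (g : G), J (a *: x + y) g = a *: J x g + J y g) /\
    (forall (x y : X) (g : G), J (BL_join x y) g = BL_join (J x g) (J y g)) /\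
    (forall (x : X) (g : G), `|J x g| <= `|x|) /\
    (forall (x : X) (c : R), 0 <= c -> (forall g, `|J x g| <= c) -> `|x| <= c).

(* Q : X -> Y is a lattice quotient map: a surjective lattice homomorphism such
   that ||y|| = inf { ||x|| : Q x = y }.  Then Y is lattice isometric to
   X / ker Q with ker Q a closed ideal, and every X / I arises this way. *)
Definition lattice_quotient_map (R : realType) (X Y : BanachLattice R) (Q : X -> Y) :=
  lattice_hom Q /\
  (forall x : X, `|Q x| <= `|x|) /\
  (forall (y : Y) (e : R), 0 < e -> exists x : X, Q x = y /\ `|x| < `|y| + e).

Definition closed_under_quotients (R : realType) (D : BLclass R) :=
  forall (X Y : BanachLattice R) (Q : X -> Y),
    D X -> lattice_quotient_map Q -> D Y.

(* Main.v *)
(** The pushout is the universal receptacle for contractive cocones. Let t range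
    over the formal lattice-linear terms with generators in X1 and X2, and let
    |t| be the supremum of |eval t| over all cocones X1 -> H <- X2 made of
    contractive lattice homomorphisms with H in C. Choosing, for each c < |t|, one
    cocone that witnesses it gives a small family (H_g), and PO is the closure, in
    the l_infty-sum of the H_g, of the families of evaluations of terms; so PO lies
    in the class by construction. Given R1, R2 into Z in the class, composing with
    the coordinates of Z and rescaling yields contractive cocones into C, whence
    |eval_Z t| <= max(|R1|, |R2|) |t|, and gamma is the continuous extension of
    eval_Z. Uniqueness holds because lattice homomorphisms between Banach lattices
    are automatically bounded and the terms are dense. *)

Require Import Defs.
From HB Require Import structures.
From mathcomp Require Import all_boot all_order all_algebra.
From mathcomp Require Import all_classical all_reals all_analysis.
From mathcomp Require Import ring lra.
Set Implicit Arguments.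
Unset Strict Implicit.
Unset Printing Implicit Defensive.
Import Order.TTheory GRing.Theory Num.Theory.
Import numFieldNormedType.Exports.
Local Open Scope classical_set_scope.
Local Open Scope ring_scope.

(** * Riesz space inequalities and automatic boundedness *)

Lemma mul_half_expr_small (R : realType) (K e : R) :
  0 < e -> exists N, forall n, (N <= n)%N -> K * 2^-1 ^+ n < e.
Proof.
have r0 : (fun n => K * 2^-1 ^+ n) @ \oo --> (0 : R).
  rewrite -[0](mulr0 K); apply: cvgM; first exact: cvg_cst.
  by apply: cvg_expr; rewrite ger0_norm ?invr_ge0// invf_lt1// ltr1n.
move=> e0; have [N _ hN] := cvgr_lt 0 r0 _ e0.
by exists N => n /hN.
Qed.

Lemma lin_dist (R : realType) (V : normedModType R) (a : R) (x y z t : V) :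
  `|a *: x + z - (a *: y + t)| <= `|a| * `|x - y| + `|z - t|.
Proof.
by rewrite opprD addrACA -scalerBr -normrZ; exact: ler_normD.
Qed.

Lemma norm_le_mul_eq0 (R : realType) (V : normedModType R) (K : R) (x : V) :
  (forall e : R, 0 < e -> `|x| <= K * e) -> x = 0.
Proof.
move=> h; apply/eqP; rewrite -normr_le0 leNgt; apply/negP => x0.
(* If x is nonzero, the case e = 1 forces K > 0, so |x| / (2K) is an admissible e. *)
have K0 : 0 < K by have := lt_le_trans x0 (h 1 ltr01); rewrite mulr1.
have /h : 0 < `|x| / (K * 2) by rewrite divr_gt0// mulr_gt0.
have -> : K * (`|x| / (K * 2)) = `|x| / 2 by field; rewrite gt_eqF.
lra.
Qed.

(** The explicit rate passes to the limit by continuity of the norm. It serves both the series in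
    the boundedness proof and the extension of evaluations to [po]. *)
Lemma geometric_cauchy_limit (R : realType)
    (V : completeNormedModType R) (u : nat -> V) (K : R) :
  (forall n m, (n <= m)%N -> `|u m - u n| <= K * 2^-1 ^+ n) ->
  exists l, forall n, `|l - u n| <= K * 2^-1 ^+ n.
Proof.
move=> hu.
have cu : cvgn u.
  apply: cauchy_cvg; apply: cauchy_exP => e e0.
  have [N hN] := mul_half_expr_small K e0.
  exists (u N); exists N => // m /= Nm; rewrite -ball_normE /= distrC.
  exact: le_lt_trans (hu _ _ Nm) (hN _ _).
exists (limn u) => n.
have : (fun m => `|u m - u n|) @ \oo --> `|limn u - u n|.
  by apply: cvg_norm; apply: cvgB => //; exact: cvg_cst.
move=> /cvgr_to_le; apply.
by exists n => // m /= nm; exact: hu.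
Qed.

Section BanachLatticeTheory.
Variables (R : realType) (X : BanachLattice R).
Implicit Types x y z : X.

Definition BL_abs x := BL_join x (- x).

Lemma BL_leD x y z t : BL_le x y -> BL_le z t -> BL_le (x + z) (y + t).
Proof.
move=> xy zt; apply: BL_le_trans (BL_le_add z xy) _.
by rewrite ![y + _]addrC; exact: BL_le_add.
Qed.

Lemma BL_leBlDr x y z : BL_le (x - y) z <-> BL_le x (z + y).
Proof.
split=> [/(BL_le_add y)|/(BL_le_add (- y))]; first by rewrite subrK.
by rewrite addrK.
Qed.

Lemma BL_leN x y : BL_le x y -> BL_le (- y) (- x).
Proof. by move/(BL_le_add (- x - y)); rewrite addrA subrr sub0r addrCA subrr addr0. Qed.

Lemma BL_le_abs x : BL_le x (BL_abs x).
Proof. exact: BL_join_ubl. Qed.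

Lemma BL_leN_abs x : BL_le (- x) (BL_abs x).
Proof. exact: BL_join_ubr. Qed.

Lemma BL_abs_ge0 x : BL_le 0 (BL_abs x).
Proof.
have := BL_leD (BL_le_abs x) (BL_leN_abs x); rewrite subrr.
move/(@BL_le_scale _ X 2^-1 _ _ ltac:(by rewrite invr_ge0)).
by rewrite scaler0 -mulr2n -[BL_abs x *+ 2]scaler_nat scalerA mulVf// scale1r.
Qed.

Lemma BL_joinC x y : BL_join x y = BL_join y x.
Proof.
by apply: BL_le_anti; apply: BL_join_least;
  (exact: BL_join_ubl || exact: BL_join_ubr).
Qed.

Lemma BL_absN x : BL_abs (- x) = BL_abs x.
Proof. by rewrite /BL_abs opprK BL_joinC. Qed.

Lemma BL_joinxx x : BL_join x x = x.
Proof.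
by apply: BL_le_anti; [apply: BL_join_least; exact: BL_le_refl|exact: BL_join_ubl].
Qed.

Lemma BL_join_l x y : BL_le y x -> BL_join x y = x.
Proof.
move=> yx; apply: BL_le_anti; last exact: BL_join_ubl.
by apply: BL_join_least => //; exact: BL_le_refl.
Qed.

Lemma BL_abs_id x : BL_le 0 x -> BL_abs x = x.
Proof.
move=> x0; apply: BL_join_l; apply: (BL_le_trans _ x0).
by rewrite -oppr0; exact: BL_leN.
Qed.

Lemma BL_norm_abs x : `|BL_abs x| = `|x|.
Proof.
have e : BL_abs (BL_abs x) = BL_abs x by apply: BL_abs_id; exact: BL_abs_ge0.
by apply/eqP; rewrite eq_le; apply/andP; split; apply: BL_lattice_norm;
  rewrite -/(BL_abs _) -/(BL_abs _) e; exact: BL_le_refl.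
Qed.

Lemma BL_norm_le x y : BL_le 0 x -> BL_le x y -> `|x| <= `|y|.
Proof.
move=> x0 xy; apply: BL_lattice_norm.
by rewrite -/(BL_abs x) -/(BL_abs y) !BL_abs_id//; exact: BL_le_trans xy.
Qed.

Lemma BL_join_le_add_abs x y z :
  BL_le (BL_join x z) (BL_join y z + BL_abs (x - y)).
Proof.
apply: BL_join_least.
  rewrite -[x in BL_le x](subrK y) addrC; apply: BL_leD (BL_le_abs _).
  exact: BL_join_ubl.
by rewrite -[z in BL_le z]addr0; apply: BL_leD (BL_abs_ge0 _); exact: BL_join_ubr.
Qed.

(** The preceding bound and its mirror image in x and y give the inequality in the order, for
    absolute values; the lattice norm carries it over. *)
Lemma BL_join_dist x y z : `|BL_join x z - BL_join y z| <= `|x - y|.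
Proof.
apply: BL_lattice_norm; rewrite -/(BL_abs (x - y)); apply: BL_join_least.
  by apply/BL_leBlDr; rewrite addrC; exact: BL_join_le_add_abs.
rewrite opprB; apply/BL_leBlDr; rewrite addrC.
by rewrite -opprB BL_absN; exact: BL_join_le_add_abs.
Qed.

Lemma BL_join_dist2 x y z t :
  `|BL_join x z - BL_join y t| <= `|x - y| + `|z - t|.
Proof.
rewrite -(subrK (BL_join y z) (BL_join x z)) -addrA.
apply: le_trans (ler_normD _ _) _; apply: lerD; first exact: BL_join_dist.
by rewrite ![BL_join y _]BL_joinC; exact: BL_join_dist.
Qed.

Lemma BL_norm_join x y : `|BL_join x y| <= `|x| + `|y|.
Proof. by have := BL_join_dist2 x 0 y 0; rewrite BL_joinxx !subr0. Qed.

(** Scaling by a > 0 is an order isomorphism with inverse scaling by a^-1. This makes the rescaled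
    coordinate maps in [leval_le] lattice homomorphisms. *)
Lemma BL_scale_join (a : R) x y :
  0 < a -> a *: BL_join x y = BL_join (a *: x) (a *: y).
Proof.
move=> a0; apply: BL_le_anti; last first.
  by apply: BL_join_least; apply: BL_le_scale (ltW a0) _;
    [exact: BL_join_ubl|exact: BL_join_ubr].
have: BL_le (BL_join x y) (a^-1 *: BL_join (a *: x) (a *: y)).
  have ai : 0 <= a^-1 by rewrite invr_ge0 ltW.
  by apply: BL_join_least;
    [have := BL_le_scale ai (BL_join_ubl (a *: x) (a *: y))
    |have := BL_le_scale ai (BL_join_ubr (a *: x) (a *: y))];
    rewrite scalerA mulVf ?gt_eqF// scale1r.
by move/(BL_le_scale (ltW a0)); rewrite scalerA mulfV ?gt_eqF// scale1r.
Qed.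

End BanachLatticeTheory.

(** * Lattice homomorphisms and their automatic boundedness *)

Section LatticeHom.
Variables (R : realType) (X Y : BanachLattice R) (T : X -> Y).
Hypothesis hT : lattice_hom T.

Lemma lattice_homP (a : R) x y : T (a *: x + y) = a *: T x + T y.
Proof. by case: hT => lT _; exact: lT. Qed.

Lemma lattice_hom_join x y : T (BL_join x y) = BL_join (T x) (T y).
Proof. by case: hT. Qed.

Lemma lattice_hom0 : T 0 = 0.
Proof.
have := lattice_homP (-1) 0 0.
by rewrite scaler0 addr0 scaleN1r addNr.
Qed.

Lemma lattice_homZ (a : R) x : T (a *: x) = a *: T x.
Proof. by have := lattice_homP a x 0; rewrite lattice_hom0 !addr0. Qed.

Lemma lattice_homB x y : T (x - y) = T x - T y.
Proof. by rewrite addrC -scaleN1r lattice_homP scaleN1r addrC. Qed.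

Lemma lattice_hom_abs x : T (BL_abs x) = BL_abs (T x).
Proof. by rewrite /BL_abs lattice_hom_join -scaleN1r lattice_homZ scaleN1r. Qed.

Lemma lattice_hom_le x y : BL_le x y -> BL_le (T x) (T y).
Proof.
move=> xy; rewrite -(BL_join_l xy) lattice_hom_join; exact: BL_join_ubr.
Qed.

(* Otherwise pick y_n >= 0 with |y_n| = 2^-n and |T y_n| > 2^n: the sum s of the
   y_n dominates every y_n, hence |T s| > 2^n for all n. *)
Lemma lattice_hom_bounded : exists2 c : R, 0 < c & opnorm_le T c.
Proof.
apply: contrapT => nb.
have h n : exists y : X, [/\ BL_le 0 y, `|y| = 2^-1 ^+ n & 2 ^+ n < `|T y|].
  have p2 : 0 < 2 ^+ n :> R by rewrite exprn_gt0.
  (* The constant 4^n leaves a factor 2^n for the image after |x| is rescaled to norm 2^-n. *)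
  have [x hx] : exists x, 4 ^+ n * `|x| < `|T x|.
    apply: contrapT => hx; apply: nb; exists (4 ^+ n); first by rewrite exprn_gt0.
    by move=> x; rewrite leNgt; apply/negP => ?; apply: hx; exists x.
  have x0 : 0 < `|x|.
    rewrite normr_gt0; apply/eqP => x0; move: hx.
    by rewrite x0 lattice_hom0 !normr0 mulr0 ltxx.
  have a0 : 0 < (2 ^+ n * `|x|)^-1 by rewrite invr_gt0 mulr_gt0.
  exists ((2 ^+ n * `|x|)^-1 *: BL_abs x); split.
  - rewrite -(scaler0 _ (2 ^+ n * `|x|)^-1); apply: BL_le_scale (ltW a0) _.
    exact: BL_abs_ge0.
  - rewrite normrZ BL_norm_abs gtr0_norm// exprVn invfM -mulrA mulVf ?mulr1//.
    by rewrite gt_eqF.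
  - rewrite lattice_homZ lattice_hom_abs normrZ BL_norm_abs gtr0_norm//.
    rewrite mulrC ltr_pdivlMr ?mulr_gt0// mulrA.
    by rewrite -exprMn -natrM.
pose y n := sval (cid (h n)).
have y0 n : BL_le 0 (y n) by rewrite /y; case: cid => ? [].
have yn n : `|y n| = 2^-1 ^+ n by rewrite /y; case: cid => ? [].
have Ty n : 2 ^+ n < `|T (y n)| by rewrite /y; case: cid => ? [].
pose S n := \sum_(i < n) y i.
have S_ge n m : (n < m)%N -> BL_le (y n) (S m).
  elim: m => // m IH; rewrite ltnS leq_eqVlt => /predU1P[->|/IH le].
    rewrite /S big_ord_recr/= -[X in BL_le X]add0r.
    apply: BL_leD (BL_le_refl _).
    elim: (m) => [|k IHk]; first by rewrite big_ord0; exact: BL_le_refl.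
    by rewrite big_ord_recr/= -[X in BL_le X]addr0; exact: BL_leD.
  by rewrite /S big_ord_recr/= -[X in BL_le X]addr0; exact: BL_leD.
have S_cauchy n m : (n <= m)%N -> `|S m - S n| <= 2 * 2^-1 ^+ n.
  move=> nm.
  (* The exact value of the geometric sum from n to m - 1 is what the induction on m can carry. *)
  suff : `|S m - S n| <= 2 * (2^-1 ^+ n - 2^-1 ^+ m).
    have : 0 <= 2^-1 ^+ m :> R by rewrite exprn_ge0// invr_ge0.
    by move=> *; lra.
  elim: m nm => [|m IH].
    by rewrite leqn0 => /eqP ->; rewrite !subrr normr0 mulr0.
  rewrite leq_eqVlt => /predU1P[->|/IH le]; first by rewrite !subrr normr0 mulr0.
  rewrite /S big_ord_recr/= addrAC; apply: le_trans (ler_normD _ _) _.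
  by rewrite yn exprS; move: le; rewrite /S; lra.
have [s hs] := geometric_cauchy_limit S_cauchy.
have y_le n : BL_le (y n) s.
  (* The relation y_n <= s is the equation s v y_n = s. It holds for S_N in place of s when N > n,
     and passes to the limit because joins are 1-Lipschitz. *)
  suff /subr0_eq -> : s - BL_join s (y n) = 0 by exact: BL_join_ubr.
  apply: (@norm_le_mul_eq0 _ _ 2) => e e0.
  have [N nN le_e] : exists2 N, (n < N)%N & 2 * 2^-1 ^+ N <= e.
    have [M hM] := @mul_half_expr_small R 2 e e0.
    exists (maxn M n.+1); first exact: leq_maxr.
    by apply/ltW/hM; exact: leq_maxl.
  have := BL_join_dist s (S N) (y n); rewrite (BL_join_l (S_ge _ _ nN)) => hj.
  have sN : `|s - S N| <= e by exact: le_trans le_e.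
  rewrite -(subrK (S N) s) -addrA {1}(subrK (S N) s).
  apply: le_trans (ler_normD _ _) _; rewrite -[X in _ + `|X|]opprB normrN; lra.
(* For N with |T s| < 2^N, positivity gives 0 <= T y_N <= T s, which contradicts 2^N < |T y_N|. *)
have [N] := @mul_half_expr_small R `|T s| 1 ltr01; move/(_ N (leqnn N)).
rewrite exprVn ltr_pdivrMr ?exprn_gt0// mul1r => lt1.
have := lt_trans lt1 (Ty N); rewrite ltNge => /negP; apply.
apply: BL_norm_le; last exact: lattice_hom_le.
by rewrite -lattice_hom0; exact: lattice_hom_le.
Qed.

End LatticeHom.

(** * Closed sublattices of l_infty-sums *)

(** The ambient l_infty-sum is never built: membership is a predicate on families, and [cs_closed]
    is norm closure written as uniform approximation in the coordinates. *)
Record closed_sublattice (R : realType) (G : Type) (F : G -> BanachLattice R) := {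
  cs_set :> (forall g, F g) -> Prop;
  cs_bounded : forall f, cs_set f -> exists M : R, forall g, `|f g| <= M;
  cs_zero : cs_set (fun g => 0);
  cs_linear : forall (a : R) f h, cs_set f -> cs_set h ->
    cs_set (fun g => a *: f g + h g);
  cs_joined : forall f h, cs_set f -> cs_set h ->
    cs_set (fun g => BL_join (f g) (h g));
  cs_closed : forall f,
    (forall e : R, 0 < e -> exists2 h, cs_set h & forall g, `|f g - h g| <= e) ->
    cs_set f }.

Section ClosedSublattice.
Variables (R : realType) (G : Type) (F : G -> BanachLattice R).
Variable S : closed_sublattice F.

Definition cs_type : Type := {f : forall g, F g | S f}.

Definition cs_val (f : cs_type) : forall g, F g := sval f.
Coercion cs_val : cs_type >-> Funclass.

Implicit Types f h k : cs_type.

HB.instance Definition _ := gen_eqMixin cs_type.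
HB.instance Definition _ := gen_choiceMixin cs_type.

Lemma cs_ext f h : (forall g, f g = h g) -> f = h.
Proof.
case: f h => [f Sf] [h Sh] /= fh.
have {}fh : f = h by exact: functional_extensionality_dep.
by subst h; congr exist; exact: Prop_irrelevance.
Qed.

Lemma cs_opp_subproof f : S (fun g => - f g).
Proof.
have := cs_linear (-1) (svalP f) (cs_zero S).
congr (cs_set S _); apply: functional_extensionality_dep => g.
by rewrite scaleN1r addr0.
Qed.

Lemma cs_add_subproof f h : S (fun g => f g + h g).
Proof.
have := cs_linear 1 (svalP f) (svalP h).
congr (cs_set S _); apply: functional_extensionality_dep => g.
by rewrite scale1r.
Qed.

Lemma cs_scale_subproof (a : R) f : S (fun g => a *: f g).
Proof.
have := cs_linear a (svalP f) (cs_zero S).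
congr (cs_set S _); apply: functional_extensionality_dep => g.
by rewrite addr0.
Qed.

Definition cs_zero_elt : cs_type := exist _ _ (cs_zero S).
Definition cs_opp f : cs_type := exist _ _ (cs_opp_subproof f).
Definition cs_add f h : cs_type := exist _ _ (cs_add_subproof f h).
Definition cs_scale (a : R) f : cs_type := exist _ _ (cs_scale_subproof a f).
Definition cs_join f h : cs_type := exist _ _ (cs_joined (svalP f) (svalP h)).

Lemma cs_addA : associative cs_add.
Proof. by move=> f h k; apply: cs_ext => g; exact: addrA. Qed.

Lemma cs_addC : commutative cs_add.
Proof. by move=> f h; apply: cs_ext => g; exact: addrC. Qed.

Lemma cs_add0 : left_id cs_zero_elt cs_add.
Proof. by move=> f; apply: cs_ext => g; exact: add0r. Qed.

Lemma cs_addN : left_inverse cs_zero_elt cs_opp cs_add.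
Proof. by move=> f; apply: cs_ext => g; exact: addNr. Qed.

HB.instance Definition _ :=
  GRing.isZmodule.Build cs_type cs_addA cs_addC cs_add0 cs_addN.

Lemma cs_scaleA (a b : R) f : cs_scale a (cs_scale b f) = cs_scale (a * b) f.
Proof. by apply: cs_ext => g; exact: scalerA. Qed.

Lemma cs_scale1 : left_id 1 cs_scale.
Proof. by move=> f; apply: cs_ext => g; exact: scale1r. Qed.

Lemma cs_scaleDr : right_distributive cs_scale +%R.
Proof. by move=> a f h; apply: cs_ext => g; exact: scalerDr. Qed.

Lemma cs_scaleDl f : {morph cs_scale^~ f : a b / a + b}.
Proof. by move=> a b; apply: cs_ext => g; exact: scalerDl. Qed.

HB.instance Definition _ := GRing.Zmodule_isLmodule.Build R cs_type
  cs_scaleA cs_scale1 cs_scaleDr cs_scaleDl.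

(* 0 is added to the set of coordinate norms so that the supremum is 0, not a
   junk value, when G is empty. *)
Definition cs_norm f : R := sup [set r | r = 0 \/ exists g, r = `|f g|].

Lemma cs_norm_has_sup f : has_sup [set r | r = 0 \/ exists g, r = `|f g|].
Proof.
split; first by exists 0; left.
have [M hM] := cs_bounded (svalP f).
exists (Num.max 0 M) => r [->|[g ->]]; first by rewrite le_max lexx.
by rewrite le_max hM orbT.
Qed.

Lemma cs_norm_coord f g : `|f g| <= cs_norm f.
Proof. by apply: sup_upper_bound; [exact: cs_norm_has_sup|right; exists g]. Qed.

Lemma cs_norm_ge0 f : 0 <= cs_norm f.
Proof. by apply: sup_upper_bound; [exact: cs_norm_has_sup|left]. Qed.

Lemma cs_norm_le f (c : R) : 0 <= c -> (forall g, `|f g| <= c) -> cs_norm f <= c.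
Proof.
move=> c0 fc; apply: ge_sup; first by exists 0; left.
by move=> r [->|[g ->]].
Qed.

Lemma cs_normD f h : cs_norm (f + h) <= cs_norm f + cs_norm h.
Proof.
apply: cs_norm_le => [|g]; first by rewrite addr_ge0// cs_norm_ge0.
by apply: le_trans (ler_normD _ _) _; apply: lerD; exact: cs_norm_coord.
Qed.

Lemma cs_normZ (a : R) f : cs_norm (a *: f) = `|a| * cs_norm f.
Proof.
have leZ b k : cs_norm (b *: k) <= `|b| * cs_norm k.
  apply: cs_norm_le => [|g]; first by rewrite mulr_ge0// cs_norm_ge0.
  have -> : cs_val (b *: k) g = b *: k g by [].
  by rewrite normrZ ler_wpM2l// cs_norm_coord.
apply/eqP; rewrite eq_le leZ/=.
have [->|a0] := eqVneq a 0; first by rewrite normr0 mul0r cs_norm_ge0.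
(* The reverse inequality is [leZ] for the inverse scalar applied to a *: f. *)
have := leZ a^-1 (a *: f); rewrite scalerA mulVf// scale1r normfV.
by rewrite ler_pdivlMl// normr_gt0.
Qed.

Lemma cs_norm0_eq0 f : cs_norm f = 0 -> f = 0.
Proof.
move=> f0; apply: cs_ext => g; apply/eqP; rewrite -normr_le0.
by have := cs_norm_coord f g; rewrite f0.
Qed.

HB.instance Definition _ := Lmodule_isNormed.Build R cs_type
  cs_normD cs_normZ cs_norm0_eq0.

(** A Cauchy filter converges in each coordinate. Its estimates are uniform in g, so the
    coordinatewise limit is a uniform one and lies in S by [cs_closed]. *)
Lemma cs_complete (A : set_system cs_type) : ProperFilter A -> cauchy A -> cvg A.
Proof.
move=> PA cA.
have near_norm (e : R) : 0 < e -> exists k, \forall f \near A, `|k - f| < e.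
  move=> e0; have [k hk] := (cauchyP A).1 cA _ e0.
  by exists k; apply: filterS hk => f; rewrite -ball_normE.
have cvg_coord g : cvg ((fun f : cs_type => f g : F g) @ A).
  apply: cauchy_cvg; apply: cauchy_exP => e /near_norm[k hk].
  exists (k g); apply: filterS hk => f; rewrite -ball_normE/= => kf.
  exact: le_lt_trans (cs_norm_coord (k - f) g) kf.
pose l g : F g := lim ((fun f : cs_type => f g : F g) @ A).
have l_close (e : R) k : 0 < e -> (\forall f \near A, `|k - f| < e) ->
    forall g, `|k g - l g| <= e.
  move=> e0 hk g.
  have : (fun f : cs_type => `|k g - f g|) @ A --> `|k g - l g|.
    by apply: cvg_norm; apply: cvgB; [exact: cvg_cst|exact: cvg_coord].
  move=> /cvgr_to_le; apply; apply: filterS hk => f /ltW; apply: le_trans.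
  exact: (cs_norm_coord (k - f) g).
have Sl : S l.
  apply: cs_closed => e e0; have [k hk] := near_norm e e0.
  exists k; first exact: svalP.
  by move=> g; rewrite distrC; exact: l_close.
apply/cvg_ex; exists (exist _ l Sl : cs_type).
apply/fcvgrPdist_lt => e e0.
have e20 : 0 < e / 2 by rewrite divr_gt0.
have [k hk] := near_norm _ e20.
apply: filterS (hk) => f kf.
rewrite -(subrK k (exist _ l Sl : cs_type)) -addrA.
apply: le_lt_trans (ler_normD _ _) _.
have : `|(exist _ l Sl : cs_type) - k| <= e / 2.
  apply: cs_norm_le => [|g]; first exact: ltW.
  by have := l_close _ k e20 hk g; rewrite distrC.
lra.
Qed.

HB.instance Definition _ := Uniform_isComplete.Build cs_type cs_complete.

Definition cs_le f h := forall g, BL_le (f g) (h g).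

Lemma cs_lattice_norm f h :
  cs_le (cs_join f (- f)) (cs_join h (- h)) -> `|f| <= `|h|.
Proof.
move=> fh; apply: cs_norm_le => [|g]; first exact: cs_norm_ge0.
by apply: le_trans (cs_norm_coord h g); apply: BL_lattice_norm; exact: fh.
Qed.

Program Definition cs_BanachLattice : BanachLattice R :=
  {| BL_sort := cs_type : completeNormedModType R;
     BL_le := cs_le; BL_join := cs_join;
     BL_lattice_norm := cs_lattice_norm |}.
Next Obligation. by move=> f g; exact: BL_le_refl. Qed.
Next Obligation. by move=> f h fh hf; apply: cs_ext => g; exact: BL_le_anti. Qed.
Next Obligation. by move=> f h k fh hk g; exact: BL_le_trans (hk g). Qed.
Next Obligation. by move=> f h k fh g; exact: BL_le_add. Qed.
Next Obligation. by move=> a f h a0 fh g; exact: BL_le_scale. Qed.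
Next Obligation. by move=> f h g; exact: BL_join_ubl. Qed.
Next Obligation. by move=> f h g; exact: BL_join_ubr. Qed.
Next Obligation. by move=> f h k fk hk g; exact: BL_join_least. Qed.

Lemma closure_class_cs (C : BLclass R) :
  (forall g, C (F g)) -> closure_class C cs_BanachLattice.
Proof.
move=> CF; exists G, F, (fun f : cs_type => cs_val f).
by split=> //; do 2!split=> //; split; [exact: cs_norm_coord|exact: cs_norm_le].
Qed.

End ClosedSublattice.

(** * Construction of the pushout *)

Section Pushout.
Variables (R : realType) (C : BLclass R) (X0 X1 X2 : BanachLattice R).
Variables (T1 : X0 -> X1) (T2 : X0 -> X2).

(** Terms are not quotiented by the vector lattice identities; terms with equal evaluations become
    equal only as elements of [po]. *)
Inductive lterm : Type :=
  | Gen1 of X1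
  | Gen2 of X2
  | Lin of R & lterm & lterm
  | Join of lterm & lterm.

Fixpoint leval (Z : BanachLattice R) (R1 : X1 -> Z) (R2 : X2 -> Z) t : Z :=
  match t with
  | Gen1 x => R1 x
  | Gen2 x => R2 x
  | Lin a s t => a *: leval R1 R2 s + leval R1 R2 t
  | Join s t => BL_join (leval R1 R2 s) (leval R1 R2 t)
  end.

Definition cocone (Z : BanachLattice R) (R1 : X1 -> Z) (R2 : X2 -> Z) :=
  [/\ lattice_hom R1, lattice_hom R2 & R1 \o T1 = R2 \o T2].

Lemma lattice_hom_comp (X Y Z : BanachLattice R) (h : Y -> Z) (k : X -> Y) :
  lattice_hom h -> lattice_hom k -> lattice_hom (h \o k).
Proof.
move=> hh hk; split=> [a x y|x y] /=; first by rewrite !lattice_homP.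
by rewrite !lattice_hom_join.
Qed.

Lemma cocone_comp (Y Z : BanachLattice R) (h : Y -> Z) R1 R2 :
  lattice_hom h -> cocone R1 R2 -> cocone (h \o R1) (h \o R2).
Proof.
move=> hh [h1 h2 e]; split; [exact: lattice_hom_comp..|].
by apply/funext => x /=; congr h; exact: (congr1 (@^~ x) e).
Qed.

Lemma leval_comp (Y Z : BanachLattice R) (h : Y -> Z) R1 R2 t :
  lattice_hom h -> leval (h \o R1) (h \o R2) t = h (leval R1 R2 t).
Proof.
move=> hh; elim: t => //= [a s -> t ->|s -> t ->]; first by rewrite lattice_homP.
by rewrite lattice_hom_join.
Qed.

(** Targets are taken in C itself, not in its closure, so that families indexed by tests embed in an
    l_infty-sum of members of C. *)
Record test := Test {
  test_space : BanachLattice R;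
  test_map1 : X1 -> test_space;
  test_map2 : X2 -> test_space;
  test_class : C test_space;
  test_cocone : cocone test_map1 test_map2;
  test_norm1 : opnorm_le test_map1 1;
  test_norm2 : opnorm_le test_map2 1 }.

Definition test_eval (o : test) t := leval (@test_map1 o) (@test_map2 o) t.

(** Contractivity bounds the generators independently of the test, and each term constructor
    preserves such a bound. Hence evaluations form bounded families. *)
Lemma test_eval_bounded t : exists M : R, forall o, `|test_eval o t| <= M.
Proof.
elim: t => [x|x|a s [M hM] t [N hN]|s [M hM] t [N hN]].
- by exists `|x| => o; have := test_norm1 o x; rewrite mul1r.
- by exists `|x| => o; have := test_norm2 o x; rewrite mul1r.
- exists (`|a| * M + N) => o; apply: le_trans (ler_normD _ _) _.
  by rewrite normrZ; apply: lerD (hN o); rewrite ler_wpM2l//; exact: hM.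
- exists (M + N) => o; apply: le_trans (BL_norm_join _ _) _.
  by apply: lerD; [exact: hM|exact: hN].
Qed.

(* All contractive cocones with values in C form a proper class. One witness for
   each strict inequality c < |t| that some cocone satisfies is enough to compute
   the supremum of the norms of t over that class. *)
Definition po_index : Type :=
  {p : lterm * R | exists o : test, p.2 < `|test_eval o p.1|}.

Definition po_test (g : po_index) : test := sval (cid (svalP g)).

Definition po_coord t (g : po_index) : test_space (po_test g) :=
  test_eval (po_test g) t.

(** If some test exceeds c at t, then (t, c) is itself an index, and the witness chosen for it also
    exceeds c. *)
Lemma po_coord_norm_le t (c : R) :
  (forall g, `|po_coord t g| <= c) -> forall o, `|test_eval o t| <= c.
Proof.
move=> h o; rewrite leNgt; apply/negP => lt_c.
pose g : po_index := exist _ (t, c) (ex_intro _ o lt_c).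
have := h g; rewrite leNgt => /negP; apply.
exact: (svalP (cid (svalP g))).
Qed.

Definition po_set (f : forall g, test_space (po_test g)) :=
  forall e : R, 0 < e -> exists t, forall g, `|f g - po_coord t g| <= e.

Lemma po_set_coord t : po_set (po_coord t).
Proof. by move=> e /ltW e0; exists t => g; rewrite subrr normr0. Qed.

Lemma po_set_bounded f : po_set f -> exists M : R, forall g, `|f g| <= M.
Proof.
move=> /(_ 1 ltr01)[t ht]; have [M hM] := test_eval_bounded t.
exists (1 + M) => g; rewrite -(subrK (po_coord t g) (f g)).
by apply: le_trans (ler_normD _ _) _; apply: lerD; [exact: ht|exact: hM].
Qed.

Lemma po_set0 : po_set (fun g => 0).
Proof.
(* Terms have no constant 0; [Gen1 0] represents it. *)
move=> e /ltW e0; exists (Gen1 0) => g.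
have [h1 _ _] := test_cocone (po_test g).
by rewrite /po_coord /test_eval/= lattice_hom0// subrr normr0.
Qed.

Lemma po_set_linear (a : R) f h :
  po_set f -> po_set h -> po_set (fun g => a *: f g + h g).
Proof.
move=> Pf Ph e e0.
(* With e' = e / (|a| + 1) the total error |a| e' + e' is exactly e, also for a = 0. *)
have a1 : 0 < `|a| + 1 by rewrite ltr_wpDl.
have e'0 : 0 < e / (`|a| + 1) by rewrite divr_gt0.
have [[s hs] [t ht]] := (Pf _ e'0, Ph _ e'0); exists (Lin a s t) => g.
apply: le_trans (lin_dist _ _ _ _ _) _.
have -> : e = `|a| * (e / (`|a| + 1)) + e / (`|a| + 1) by field; rewrite gt_eqF.
by apply: lerD; [rewrite ler_wpM2l//; exact: hs|exact: ht].
Qed.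

Lemma po_set_join f h :
  po_set f -> po_set h -> po_set (fun g => BL_join (f g) (h g)).
Proof.
move=> Pf Ph e e0; have e'0 : 0 < e / 2 by rewrite divr_gt0.
have [[s hs] [t ht]] := (Pf _ e'0, Ph _ e'0); exists (Join s t) => g.
apply: le_trans (BL_join_dist2 _ _ _ _) _.
by rewrite [e]splitr; apply: lerD; [exact: hs|exact: ht].
Qed.

Lemma po_set_closed f :
  (forall e : R, 0 < e -> exists2 h, po_set h & forall g, `|f g - h g| <= e) ->
  po_set f.
Proof.
move=> hf e e0; have e'0 : 0 < e / 2 by rewrite divr_gt0.
have [h Ph fh] := hf _ e'0; have [t ht] := Ph _ e'0; exists t => g.
rewrite -(subrK (h g) (f g)) -addrA [e]splitr.
by apply: le_trans (ler_normD _ _) _; apply: lerD; [exact: fh|exact: ht].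
Qed.

(** * The pushout space and its two injections *)

Definition po_sublattice : closed_sublattice (fun g => test_space (po_test g)) :=
  Build_closed_sublattice po_set_bounded po_set0 po_set_linear po_set_join
    po_set_closed.

Definition po : BanachLattice R := cs_BanachLattice po_sublattice.

Definition po_term t : po := exist _ (po_coord t) (po_set_coord t).

Definition po_inj1 x : po := po_term (Gen1 x).
Definition po_inj2 x : po := po_term (Gen2 x).

Lemma po_class : closure_class C po.
Proof. by apply: closure_class_cs => g; exact: test_class. Qed.

Lemma po_eq (f h : po) :
  (forall g, @cs_val _ _ _ po_sublattice f g = @cs_val _ _ _ po_sublattice h g) ->
  f = h.
Proof. exact: cs_ext. Qed.

Lemma po_termD (a : R) s t : po_term (Lin a s t) = a *: po_term s + po_term t.
Proof. exact: po_eq. Qed.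

Lemma po_termJ s t : po_term (Join s t) = BL_join (po_term s) (po_term t).
Proof. exact: po_eq. Qed.

Lemma po_dense (f : po) (e : R) : 0 < e -> exists t, `|f - po_term t| <= e.
Proof.
move=> e0; have [t ht] := svalP f e e0; exists t.
by apply: cs_norm_le => //; exact: ltW.
Qed.

Lemma po_inj1_hom : lattice_hom po_inj1.
Proof.
split=> [a x y|x y]; apply: po_eq => g; have [h1 _ _] := test_cocone (po_test g).
  exact: lattice_homP.
exact: lattice_hom_join.
Qed.

Lemma po_inj2_hom : lattice_hom po_inj2.
Proof.
split=> [a x y|x y]; apply: po_eq => g; have [_ h2 _] := test_cocone (po_test g).
  exact: lattice_homP.
exact: lattice_hom_join.
Qed.

Lemma po_cocone : cocone po_inj1 po_inj2.
Proof.
split; [exact: po_inj1_hom|exact: po_inj2_hom|].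
apply/funext => x; apply: po_eq => g; have [_ _ e] := test_cocone (po_test g).
exact: (congr1 (@^~ x) e).
Qed.

Lemma po_inj1_norm : opnorm_le po_inj1 1.
Proof.
move=> x; apply: cs_norm_le; first by rewrite mul1r.
by move=> g; exact: test_norm1.
Qed.

Lemma po_inj2_norm : opnorm_le po_inj2 1.
Proof.
move=> x; apply: cs_norm_le; first by rewrite mul1r.
by move=> g; exact: test_norm2.
Qed.

(** With [leval_comp], this determines a lattice homomorphism out of [po] on all terms from its
    composites with the injections. *)
Lemma leval_po t : leval po_inj1 po_inj2 t = po_term t.
Proof. by elim: t => //= [a s -> t ->|s -> t ->]; rewrite ?po_termD ?po_termJ. Qed.

Section EvalBound.
Variables (Z : BanachLattice R) (R1 : X1 -> Z) (R2 : X2 -> Z).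
Hypotheses (hZ : closure_class C Z) (hR : cocone R1 R2).

(** Each coordinate of Z, divided by c, turns R1 and R2 into a contractive cocone into a member of
    C, whose value at t is at most |t|. The norm of Z is recovered from its coordinates. *)
Lemma leval_le (c : R) t : 0 < c -> opnorm_le R1 c -> opnorm_le R2 c ->
  `|leval R1 R2 t| <= c * `|po_term t|.
Proof.
move=> c0 n1 n2; have [K [H [J [CH [Jl [Jj [Jle Jn]]]]]]] := hZ.
apply: Jn => [|k]; first by rewrite mulr_ge0// ltW.
pose h z := c^-1 *: J z k.
have ci0 : 0 < c^-1 by rewrite invr_gt0.
have hh : @lattice_hom _ Z (H k) h.
  split=> [a x y|x y]; rewrite /h ?Jj ?BL_scale_join// Jl scalerDr.
  by rewrite !scalerA mulrC.
have hn (X : BanachLattice R) (f : X -> Z) : opnorm_le f c -> opnorm_le (h \o f) 1.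
  move=> fc x; rewrite mul1r /= /h normrZ gtr0_norm// ler_pdivrMl//.
  exact: le_trans (Jle _ _) (fc x).
pose o := Test (CH k) (cocone_comp hh hR) (hn _ _ n1) (hn _ _ n2).
have : `|test_eval o t| <= `|po_term t|.
  apply: po_coord_norm_le => g.
  exact: (cs_norm_coord (S := po_sublattice) (po_term t)).
by rewrite /test_eval leval_comp// /h normrZ gtr0_norm// ler_pdivrMl.
Qed.

End EvalBound.

(** Applying [leval_le] to the cocone into [po] itself gives |t| <= |t| / 2, so every term vanishes,
    and terms are dense. This settles negative norm bounds below. *)
Lemma po_trivial : opnorm_le po_inj1 2^-1 -> opnorm_le po_inj2 2^-1 ->
  forall f : po, f = 0.
Proof.
have h0 : 0 < 2^-1 :> R by rewrite invr_gt0.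
move=> n1 n2 f; apply: (@norm_le_mul_eq0 _ _ 1) => e /(po_dense f)[t].
have := leval_le po_class po_cocone t h0 n1 n2; rewrite leval_po => t0.
have {t0}/normr0_eq0 -> : `|po_term t| = 0 by have := normr_ge0 (po_term t); lra.
by rewrite subr0 mul1r.
Qed.

(** * Existence, norm bound and uniqueness of the mediating map *)

Section Universal.
Variables (Z : BanachLattice R) (R1 : X1 -> Z) (R2 : X2 -> Z).
Hypotheses (hZ : closure_class C Z) (hR : cocone R1 R2).

Lemma cocone_bounded :
  exists c : R, [/\ 0 < c, opnorm_le R1 c & opnorm_le R2 c].
Proof.
case: hR => /lattice_hom_bounded[c c0 hc] /lattice_hom_bounded[d d0 hd] _.
exists (c + d); split; first exact: addr_gt0.
  by move=> x; apply: le_trans (hc x) _; rewrite ler_wpM2r// lerDl ltW.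
by move=> x; apply: le_trans (hd x) _; rewrite ler_wpM2r// lerDr ltW.
Qed.

(** The difference of two terms is again a term, [Lin (-1) t s], so the norm bound becomes a
    Lipschitz bound. *)
Lemma leval_dist (c : R) s t : 0 < c -> opnorm_le R1 c -> opnorm_le R2 c ->
  `|leval R1 R2 s - leval R1 R2 t| <= c * `|po_term s - po_term t|.
Proof.
move=> c0 n1 n2; have := leval_le hZ hR (Lin (-1) t s) c0 n1 n2.
by rewrite po_termD/= !scaleN1r ![- _ + _]addrC.
Qed.

(** The value z is the limit of the evaluations of terms w_n tending to f. Stating the bound against
    every t frees it from the chosen sequence. *)
Lemma leval_extend (c : R) (f : po) : 0 < c -> opnorm_le R1 c -> opnorm_le R2 c ->
  exists z, forall t, `|z - leval R1 R2 t| <= c * `|f - po_term t|.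
Proof.
move=> c0 n1 n2.
have p2 n : 0 < 2^-1 ^+ n :> R by rewrite exprn_gt0// invr_gt0.
pose w n := sval (cid (po_dense f (p2 n))).
have hw n : `|f - po_term (w n)| <= 2^-1 ^+ n by rewrite /w; case: cid.
(* The factor 2 comes from passing through f: 2^-m + 2^-n <= 2 * 2^-n for n <= m. *)
have [n m nm|z hz] := @geometric_cauchy_limit R Z (leval R1 R2 \o w) (c * 2).
  apply: le_trans (leval_dist _ _ c0 n1 n2) _; rewrite -mulrA ler_pM2l//.
  rewrite -(subrK f (po_term (w m))) -addrA.
  apply: le_trans (ler_normD _ _) _; rewrite distrC.
  have : 2^-1 ^+ m <= 2^-1 ^+ n :> R.
    by rewrite ler_wiXn2l ?invr_ge0// invf_le1// ler1n.
  have := hw n; have := hw m; lra.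
exists z => t; apply/ler_addgt0Pr => e e0.
(* Of the factor 3, two units come from the distance of z to its N-th approximant and one from the
   distance of w_N to f. *)
have [N /(_ _ (leqnn N)) hN] := mul_half_expr_small (c * 3) e0.
rewrite -(subrK (leval R1 R2 (w N)) z) -addrA.
apply: le_trans (ler_normD _ _) _.
have := leval_dist (w N) t c0 n1 n2.
have : `|po_term (w N) - po_term t| <= 2^-1 ^+ N + `|f - po_term t|.
  rewrite -(subrK f (po_term (w N))) -addrA.
  by apply: le_trans (ler_normD _ _) _; rewrite distrC lerD2r.
rewrite -(ler_pM2l c0); have := hz N; rewrite /=; lra.
Qed.

Lemma po_universal : exists gamma : po -> Z,
  [/\ lattice_hom gamma, gamma \o po_inj1 = R1, gamma \o po_inj2 = R2 &
      forall c : R, opnorm_le R1 c -> opnorm_le R2 c -> opnorm_le gamma c].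
Proof.
have [c [c0 n1 n2]] := cocone_bounded.
have ext f := cid (leval_extend f c0 n1 n2).
pose gamma f := sval (ext f).
have gammaP f t : `|gamma f - leval R1 R2 t| <= c * `|f - po_term t|.
  exact: svalP (ext f) t.
have gammaE t : gamma (po_term t) = leval R1 R2 t.
  apply/subr0_eq/eqP; rewrite -normr_le0.
  by have := gammaP (po_term t) t; rewrite subrr normr0 mulr0.
have approx f e : 0 < e ->
    exists t, `|f - po_term t| <= e /\ `|gamma f - leval R1 R2 t| <= c * e.
  move=> /(po_dense f)[t ht]; exists t; split=> //.
  by apply: le_trans (gammaP f t) _; rewrite ler_pM2l.
have gamma_norm (d : R) : 0 < d -> opnorm_le R1 d -> opnorm_le R2 d ->
    opnorm_le gamma d.
  move=> d0 m1 m2 f; apply/ler_addgt0Pr => e e0.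
  have cd : 0 < c + d by rewrite addr_gt0.
  (* The error is c e' for replacing gamma f by the value at t, plus d e' for replacing |t| by
     |f|. *)
  pose e' := e / (c + d); have e'E : (c + d) * e' = e by rewrite mulrC divfK ?gt_eqF.
  have [t [ft gt]] := approx f e' (divr_gt0 e0 cd).
  have := leval_le hZ hR t d0 m1 m2.
  have : d * `|po_term t| <= d * (`|f| + e').
    by rewrite ler_pM2l//; have := lerB_dist (po_term t) f; rewrite distrC; lra.
  have := lerB_dist (gamma f) (leval R1 R2 t); lra.
have gamma_hom : lattice_hom gamma.
  split=> [a f h|f h]; apply/subr0_eq.
    (* Both sides are compared with the evaluation of [Lin a s t], each at cost c (|a| + 1) e; for
       joins below, each comparison costs 2 c e. *)
    apply: (@norm_le_mul_eq0 _ _ (2 * c * (`|a| + 1))) => e e0.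
    have [[s [fs gs]] [t [ht gt]]] := (approx f _ e0, approx h _ e0).
    apply: le_trans (ler_distD (leval R1 R2 (Lin a s t)) _ _) _.
    have -> : 2 * c * (`|a| + 1) * e =
      c * (`|a| * e + e) + (`|a| * (c * e) + c * e) by ring.
    apply: lerD.
      apply: le_trans (gammaP _ _) _; rewrite ler_pM2l// po_termD.
      by apply: le_trans (lin_dist _ _ _ _ _) _; rewrite lerD// ler_wpM2l.
    rewrite distrC; apply: le_trans (lin_dist _ _ _ _ _) _.
    by rewrite lerD// ler_wpM2l.
  apply: (@norm_le_mul_eq0 _ _ (4 * c)) => e e0.
  have [[s [fs gs]] [t [ht gt]]] := (approx f _ e0, approx h _ e0).
  apply: le_trans (ler_distD (leval R1 R2 (Join s t)) _ _) _.
  have -> : 4 * c * e = c * (e + e) + (c * e + c * e) by ring.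
  apply: lerD.
    apply: le_trans (gammaP _ _) _; rewrite ler_pM2l// po_termJ.
    by apply: le_trans (BL_join_dist2 _ _ _ _) _; rewrite lerD.
  by rewrite distrC; apply: le_trans (BL_join_dist2 _ _ _ _) _; rewrite lerD.
exists gamma; split=> //.
- by apply/funext => x; exact: gammaE.
- by apply/funext => x; exact: gammaE.
move=> d m1 m2.
(* [gamma_norm] requires a positive bound. For d >= 0 it is applied to d + e' with e' |f| <= e; a
   negative d forces X1 and X2, hence [po], to be zero. *)
have [d0|d0] := leP 0 d.
  move=> f; apply/ler_addgt0Pr => e e0.
  have f1 : 0 < `|f| + 1 by rewrite ltr_wpDl.
  pose e' := e / (`|f| + 1); have e'0 : 0 < e' by rewrite divr_gt0.
  have e'E : e' * (`|f| + 1) = e by rewrite divfK ?gt_eqF.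
  have wk (X : BanachLattice R) (T : X -> Z) : opnorm_le T d -> opnorm_le T (d + e').
    by move=> Td x; apply: le_trans (Td x) _; rewrite ler_wpM2r// lerDl ltW.
  have := gamma_norm _ (ltr_wpDl d0 e'0) (wk _ _ m1) (wk _ _ m2) f; lra.
have triv (X : BanachLattice R) (T : X -> Z) (x : X) : opnorm_le T d -> `|x| = 0.
  move=> /(_ x); have := normr_ge0 (T x); have := normr_ge0 x; nra.
have f0 : forall f : po, f = 0.
  apply: po_trivial => x.
    by apply: le_trans (po_inj1_norm x) _; rewrite (triv _ _ x m1) !mulr0.
  by apply: le_trans (po_inj2_norm x) _; rewrite (triv _ _ x m2) !mulr0.
by move=> f; rewrite (f0 f) lattice_hom0// !normr0 mulr0.
Qed.

Lemma po_unique (gamma gamma' : po -> Z) :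
  lattice_hom gamma -> lattice_hom gamma' ->
  gamma \o po_inj1 = gamma' \o po_inj1 -> gamma \o po_inj2 = gamma' \o po_inj2 ->
  gamma = gamma'.
Proof.
move=> hg hg' e1 e2.
have [[c c0 hc] [d d0 hd]] := (lattice_hom_bounded hg, lattice_hom_bounded hg').
have eqt t : gamma (po_term t) = gamma' (po_term t).
  by rewrite -leval_po -!leval_comp// e1 e2.
apply/funext => f; apply/subr0_eq; apply: (@norm_le_mul_eq0 _ _ (c + d)) => e e0.
have [t ht] := po_dense f e0.
(* The common value at t splits the difference into gamma (f - t) and gamma' (t - f). *)
rewrite -(subrK (gamma (po_term t)) (gamma f)) -addrA {2}eqt -!lattice_homB//.
apply: le_trans (ler_normD _ _) _; rewrite mulrDl; apply: lerD.
  by apply: le_trans (hc _) _; rewrite ler_pM2l.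
by apply: le_trans (hd _) _; rewrite ler_pM2l// distrC.
Qed.

End Universal.
End Pushout.

Theorem mainTheorem15 (R : realType) (C : BLclass R)
  (C_nonempty : exists X : BanachLattice R, C X)
  (C_quot : closed_under_quotients (closure_class C))
  (X0 X1 X2 : BanachLattice R)
  (hX0 : closure_class C X0) (hX1 : closure_class C X1) (hX2 : closure_class C X2)
  (T1 : X0 -> X1) (T2 : X0 -> X2)
  (hT1 : lattice_hom T1) (hT1b : bounded_op T1)
  (hT2 : lattice_hom T2) (hT2b : bounded_op T2) :
  exists (PO : BanachLattice R) (S1 : X1 -> PO) (S2 : X2 -> PO),
    [/\ closure_class C PO,
        lattice_hom S1 /\ lattice_hom S2,
        opnorm_le S1 1 /\ opnorm_le S2 1,
        S1 \o T1 = S2 \o T2 &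
        forall (Z : BanachLattice R) (R1 : X1 -> Z) (R2 : X2 -> Z),
          closure_class C Z -> lattice_hom R1 -> lattice_hom R2 ->
          R1 \o T1 = R2 \o T2 ->
          exists gamma : PO -> Z,
            [/\ lattice_hom gamma, gamma \o S1 = R1, gamma \o S2 = R2,
                (forall c : R, opnorm_le R1 c -> opnorm_le R2 c -> opnorm_le gamma c) &
                (forall gamma' : PO -> Z, lattice_hom gamma' ->
                   gamma' \o S1 = R1 -> gamma' \o S2 = R2 -> gamma' = gamma)]].
Proof.
exists (po C T1 T2), (@po_inj1 R C X0 X1 X2 T1 T2), (@po_inj2 R C X0 X1 X2 T1 T2).
have [hS1 hS2 hS] := po_cocone C T1 T2.
split=> //; first exact: po_class.
  by split; [exact: po_inj1_norm|exact: po_inj2_norm].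
move=> Z R1 R2 hZ hR1 hR2 hR.
have [gamma [hg g1 g2 gn]] := po_universal hZ (And3 hR1 hR2 hR).
exists gamma; split=> // gamma' hg' g1' g2'.
by apply: po_unique => //; rewrite ?g1 ?g1' ?g2 ?g2'.
Qed.
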